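(* Let $T:M\to\mathcal{A}$ be an $\mathcal{O}$-operator on an associative conformal algebra $\mathcal{A}$ with respect to a conformal $\mathcal{A}$-bimodule $M$. Then $T$ is also an $\mathcal{O}$-operator on the commutator Lie conformal algebra $\mathcal{A}^L$ with respect to the representation $(M,\rho)$ given by $\rho(a)_\lambda m=a_\lambda m-m_{-\lambda-\partial}a$ for $a\in\mathcal{A}^L$, $m\in M$; that is, for all $m,n\in M$, $$[T(m)_\lambda T(n)]^L=T\big(\rho(T(m))_\lambda n-\rho(T(n))_{-\lambda-\partial}m\big).$$
   Context: All vector spaces are over $\mathbb{C}$. For $\mathbb{C}[\partial]$-modules $U,V,W$, a $\mathbb{C}$-bilinear map $U\times V\to W[\lambda]$, $(u,v)\mapsto u_\lambda v$, is conformal sesquilinear if $(\partial u)_\lambda v=-\lambda\, u_\lambda v$ and $u_\lambda(\partial v)=(\partial+\lambda)(u_\lambda v)$. Maps are extended coefficientwise to polynomials. If $u_\mu v=\sum_j\mu^j w_j$, then $u_{-\lambda-\partial}v:=\sum_j(-\lambda-\partial)^j w_j$. An associative conformal algebra is a $\mathbb{C}[\partial]$-module $\mathcal{A}$ with a conformal sesquilinear map $(a,b)\mapsto a_\lambda b\in\mathcal{A}[\lambda]$ with $(a_\lambda b)_{\lambda+\mu}c=a_\lambda(b_\mu c)$. A conformal $\mathcal{A}$-bimodule is a $\mathbb{C}[\partial]$-module $M$ with conformal sesquilinear maps $(a,m)\mapsto a_\lambda m\in M[\lambda]$ and $(m,a)\mapsto m_\lambda a\in M[\lambda]$ such that $(a_\lambda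 b)_{\lambda+\mu}m=a_\lambda(b_\mu m)$, $(m_\lambda a)_{\lambda+\mu}b=m_\lambda(a_\mu b)$, $(a_\lambda m)_{\lambda+\mu}b=a_\lambda(m_\mu b)$. An $\mathcal{O}$-operator on $\mathcal{A}$ with respect to $M$ is a $\mathbb{C}[\partial]$-module homomorphism $T:M\to\mathcal{A}$ with $T(m)_\lambda T(n)=T(T(m)_\lambda n+m_\lambda T(n))$ for all $m,n\in M$. The commutator Lie conformal algebra $\mathcal{A}^L$ is the $\mathbb{C}[\partial]$-module $\mathcal{A}$ with $\lambda$-bracket $[a_\lambda b]^L=a_\lambda b-b_{-\lambda-\partial}a$. An $\mathcal{O}$-operator of a Lie conformal algebra $\mathcal{L}$ associated with a representation $\rho$ of $\mathcal{L}$ on a $\mathbb{C}[\partial]$-module $V$ is a $\mathbb{C}[\partial]$-module homomorphism $T:V\to\mathcal{L}$ with $[T(u)_\lambda T(v)]=T(\rho(T(u))_\lambda v-\rho(T(v))_{-\lambda-\partial}u)$ for all $u,v\in V$. *)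

(* Defs.v *)
From HB Require Import structures.
From mathcomp Require Import all_boot all_order all_algebra.
From mathcomp Require Import finmap monalg complex reals.

Set Implicit Arguments.
Unset Strict Implicit.
Unset Printing Implicit Defensive.
Import GRing.Theory.
Local Open Scope ring_scope.

(* [{malg W[nat]}] is the group W[lambda] of finitely supported sequences of
   coefficients in W.  W[lambda, mu] is [{malg {malg W[nat]}[nat]}], with
   lambda the inner variable and mu the outer one. *)
Section PolynomialsWithCoefficientsInAGroup.
Variables U V : zmodType.

(* \sum_j X^j (f w_j) for P = \sum_j lambda^j w_j *)
Definition msubst (X : V -> V) (f : U -> V) (P : {malg U[nat]}) : V :=
  \sum_(j <- msupp P) iter j X (f P@_j).

Definition coefmap (f : U -> V) (P : {malg U[nat]}) : {malg V[nat]} :=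
  \sum_(j <- msupp P) << f P@_j *g j >>.

Definition constp (w : U) : {malg U[nat]} := << w *g 0%N >>.

Definition mulvar (P : {malg U[nat]}) : {malg U[nat]} :=
  \sum_(j <- msupp P) << P@_j *g j.+1 >>.

End PolynomialsWithCoefficientsInAGroup.

Definition mul_lambda (W : zmodType) :
  {malg {malg W[nat]}[nat]} -> {malg {malg W[nat]}[nat]} :=
  coefmap (@mulvar W).

Definition mul_mu (W : zmodType) :
  {malg {malg W[nat]}[nat]} -> {malg {malg W[nat]}[nat]} :=
  @mulvar {malg W[nat]}.

(* A K[d]-module is an lmodule over {poly K}, with d acting as 'X. *)
Section Conformal.
Variable K : fieldType.

Definition partial (W : lmodType {poly K}) (w : W) : W := 'X *: w.

(* P(lambda) |-> P(- lambda - d): from u_lambda v to u_{- lambda - d} v *)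
Definition skew_subst (W : lmodType {poly K}) (P : {malg W[nat]}) :
  {malg W[nat]} :=
  msubst (fun Q => - mulvar Q - coefmap (@partial W) Q) (@constp W) P.

Record conformal_sesquilinear (U V W : lmodType {poly K})
    (p : U -> V -> {malg W[nat]}) : Prop := ConformalSesquilinear {
  sesqui_linearl : forall (c : K) (u u' : U) (v : V),
    p (c%:P *: u + u') v = coefmap (fun w => c%:P *: w) (p u v) + p u' v;
  sesqui_linearr : forall (c : K) (u : U) (v v' : V),
    p u (c%:P *: v + v') = coefmap (fun w => c%:P *: w) (p u v) + p u v';
  sesqui_partiall : forall (u : U) (v : V),
    p (partial u) v = - mulvar (p u v);
  sesqui_partialr : forall (u : U) (v : V),
    p u (partial v) = coefmap (@partial W) (p u v) + mulvar (p u v)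
}.

Section IteratedProducts.
Variables U V W X Y : lmodType {poly K}.

(* (u_lambda v)_{lambda + mu} w, with p for the inner product, q the outer *)
Definition nestl (p : U -> V -> {malg X[nat]}) (q : X -> W -> {malg Y[nat]})
    (u : U) (v : V) (w : W) : {malg {malg Y[nat]}[nat]} :=
  msubst (@mul_lambda Y)
    (fun x => msubst (fun Q => mul_lambda Q + mul_mu Q)
                     (fun y => constp (constp y)) (q x w))
    (p u v).

(* u_lambda (v_mu w) *)
Definition nestr (p : V -> W -> {malg X[nat]}) (q : U -> X -> {malg Y[nat]})
    (u : U) (v : V) (w : W) : {malg {malg Y[nat]}[nat]} :=
  coefmap (q u) (p v w).

(* v_mu (u_lambda w) *)
Definition nestr_swap (p : U -> W -> {malg X[nat]})
    (q : V -> X -> {malg Y[nat]})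
    (u : U) (v : V) (w : W) : {malg {malg Y[nat]}[nat]} :=
  msubst (@mul_lambda Y) (fun x => coefmap (@constp Y) (q v x)) (p u w).

End IteratedProducts.

Record associative_conformal (A : lmodType {poly K})
    (mulA : A -> A -> {malg A[nat]}) : Prop := AssociativeConformal {
  assoc_sesqui : conformal_sesquilinear mulA;
  assoc_mulA : forall a b c, nestl mulA mulA a b c = nestr mulA mulA a b c
}.

Record conformal_bimodule (A M : lmodType {poly K})
    (mulA : A -> A -> {malg A[nat]})
    (lact : A -> M -> {malg M[nat]})
    (ract : M -> A -> {malg M[nat]}) : Prop := ConformalBimodule {
  bimod_lsesqui : conformal_sesquilinear lact;
  bimod_rsesqui : conformal_sesquilinear ract;
  bimod_lact : forall a b m, nestl mulA lact a b m = nestr lact lact a b m;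
  bimod_ract : forall m a b, nestl ract ract m a b = nestr mulA ract m a b;
  bimod_lract : forall a m b, nestl lact ract a m b = nestr ract lact a m b
}.

Definition O_operator (A M : lmodType {poly K})
    (mulA : A -> A -> {malg A[nat]})
    (lact : A -> M -> {malg M[nat]}) (ract : M -> A -> {malg M[nat]})
    (T : {linear M -> A}) : Prop :=
  forall m n : M,
    mulA (T m) (T n) = coefmap T (lact (T m) n + ract m (T n)).

Record lie_conformal (L : lmodType {poly K})
    (br : L -> L -> {malg L[nat]}) : Prop := LieConformal {
  lie_sesqui : conformal_sesquilinear br;
  lie_skew : forall a b, br a b = - skew_subst (br b a);
  lie_jacobi : forall a b c,
    nestr br br a b c = nestl br br a b c + nestr_swap br br a b c
}.

Record lie_representation (L V : lmodType {poly K})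
    (br : L -> L -> {malg L[nat]})
    (rho : L -> V -> {malg V[nat]}) : Prop := LieRepresentation {
  rep_sesqui : conformal_sesquilinear rho;
  rep_bracket : forall a b v,
    nestl br rho a b v = nestr rho rho a b v - nestr_swap rho rho a b v
}.

Definition lie_O_operator (L V : lmodType {poly K})
    (br : L -> L -> {malg L[nat]}) (rho : L -> V -> {malg V[nat]})
    (T : {linear V -> L}) : Prop :=
  forall u v : V,
    br (T u) (T v) = coefmap T (rho (T u) v - skew_subst (rho (T v) u)).

Definition commutator (A : lmodType {poly K})
    (mulA : A -> A -> {malg A[nat]}) (a b : A) : {malg A[nat]} :=
  mulA a b - skew_subst (mulA b a).

Definition bimod_rep (A M : lmodType {poly K})
    (lact : A -> M -> {malg M[nat]}) (ract : M -> A -> {malg M[nat]})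
    (a : A) (m : M) : {malg M[nat]} :=
  lact a m - skew_subst (ract m a).

End Conformal.

(* Main.v *)
Require Import Defs.
From HB Require Import structures.
From mathcomp Require Import all_boot all_order all_algebra.
From mathcomp Require Import finmap monalg complex reals.

                                                                           
                                                                    
                                                                             
                                                                 
                                     
                                                                              
                                                                             
                                                                         
                                                   

Set Implicit Arguments.
Unset Strict Implicit.
Unset Printing Implicit Defensive.
Import GRing.Theory.
Local Open Scope ring_scope.

(** The identity for $T$ follows by writing the $\mathcal{O}$-operator identity for $T(m)_\lambda
    T(n)$ and for $T(n)_\lambda T(m)$, and subtracting from the first the skew substitution
    $\lambda\mapsto-\lambda-\partial$ of the second. Since $T$ commutes with $\partial$, it commutes
    with this substitution ([skew_subst_coefmap]).

    The longer task is to show that $\rho$ is a representation. Every iterated product lies in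
    $M[\lambda,\mu]$, where $\lambda$, $\mu$ and $\partial$ act as commuting operators. Each
    bimodule axiom therefore stays true when $\lambda,\mu$ are replaced by integral linear forms
    $t,s$ in $\lambda,\mu,\partial$ ([assoc_linop]). A skew substitution inside a product only
    changes the form, because sesquilinearity turns $\partial$ on a factor into such a form
    ([msubst_skew_substl], [msubst_skew_substr]). Both sides of the representation identity thus
    expand into terms $a_t(b_s v)$, $a_t(v_s b)$ and $(v_t a)_{t+s}b$ with forms among $\lambda$,
    $\mu$, $-\lambda-\mu-\partial$; the mixed terms cancel ([bimod_rep_bracket]). With $\mathcal{A}$
    as a bimodule over itself, the same identity is the Jacobi identity of $\mathcal{A}^L$. *)

Local Notation zmod_morphism := GRing.zmod_morphism.

(** * Additive maps between abelian groups *)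

Section ZmodMorphism.
Variables (U V : zmodType) (f : U -> V).
Hypothesis hf : zmod_morphism f.

Definition additive_of : {additive U -> V} :=
  HB.pack f (GRing.isZmodMorphism.Build U V f hf).

Lemma zmod_morph0 : f 0 = 0. Proof. exact: (raddf0 additive_of). Qed.

Lemma zmod_morphN x : f (- x) = - f x.
Proof. exact: (raddfN additive_of). Qed.

Lemma zmod_morphD x y : f (x + y) = f x + f y.
Proof. exact: (raddfD additive_of). Qed.

Lemma zmod_morphMz n x : f (x *~ n) = f x *~ n.
Proof. exact: (raddfMz additive_of n x). Qed.

Lemma zmod_morph_sum (I : Type) (r : seq I) (F : I -> U) :
  f (\sum_(i <- r) F i) = \sum_(i <- r) f (F i).
Proof. exact: (raddf_sum additive_of). Qed.

End ZmodMorphism.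

Lemma morphD_zmod (U V : zmodType) (f : U -> V) :
  {morph f : x y / x + y} -> zmod_morphism f.
Proof. by move=> hf x y; apply/(addIr (f y)); rewrite -hf !subrK. Qed.

Lemma zmod_morphism_comp (U V W : zmodType) (g : V -> W) (f : U -> V) :
  zmod_morphism g -> zmod_morphism f -> zmod_morphism (fun x => g (f x)).
Proof. by move=> hg hf x y; rewrite hf hg. Qed.

Lemma zmod_morphism_sub (U V : zmodType) (g f : U -> V) :
  zmod_morphism g -> zmod_morphism f -> zmod_morphism (fun x => g x - f x).
Proof. by move=> hg hf x y; rewrite hf hg !opprD !opprK addrACA. Qed.

(** * Sums over the coefficients of a polynomial *)

Section CoefficientSums.
Variables U V : zmodType.
Variable F : nat -> U -> V.
Hypothesis hF : forall j, zmod_morphism (F j).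

Lemma coefsum_monom w j :
  \sum_(i <- msupp (<< w *g j >> : {malg U[nat]})) F i << w *g j >>@_i = F j w.
Proof.
rewrite msuppU; case: eqP => [->|_].
  by rewrite big_seq_fset0 (zmod_morph0 (hF j)).
by rewrite big_seq_fset1 mcoeffUU.
Qed.

Lemma coefsum_zmod :
  zmod_morphism (fun P : {malg U[nat]} => \sum_(i <- msupp P) F i P@_i).
Proof.
(* The three supports differ, so all sums are extended to one finite set; the added terms vanish
   because [F j 0 = 0]. *)
have widen (P : {malg U[nat]}) (D : {fset nat}) : (msupp P `<=` D)%fset ->
    \sum_(i <- msupp P) F i P@_i = \sum_(i <- D) F i P@_i.
  move=> sPD; apply: big_fset_incl => // i _ /mcoeff_outdom ->.
  exact: zmod_morph0 (hF i).
move=> P Q; pose D := (msupp P `|` msupp Q)%fset.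
rewrite (widen _ _ (msuppB_le P Q)) (widen P D) ?fsubsetUl //.
rewrite (widen Q D) ?fsubsetUr // -sumrB.
by apply: eq_bigr => i _; rewrite mcoeffB hF.
Qed.

End CoefficientSums.

Section Monomials.
Variable U : zmodType.

Lemma constp_zmod : zmod_morphism (@constp U).
Proof. exact: monalgUB. Qed.

Lemma mulvar_zmod : zmod_morphism (@mulvar U).
Proof.
apply: (coefsum_zmod (F := fun j w => << w *g j.+1 >>)) => j.
exact: monalgUB.
Qed.

Lemma mulvar_monom (w : U) j : mulvar << w *g j >> = << w *g j.+1 >>.
Proof.
rewrite /mulvar (coefsum_monom (F := fun j w => << w *g j.+1 >>)) // => i.
exact: monalgUB.
Qed.

Lemma iter_mulvar (w : U) j : iter j (@mulvar U) (constp w) = << w *g j >>.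
Proof. by elim: j => //= j ->; rewrite mulvar_monom. Qed.

End Monomials.

(** * Substitution of an operator for the variable *)

Section OneVariable.
Variables U V : zmodType.
Implicit Types (P Q : {malg U[nat]}).

Section Msubst.
Variables (X : V -> V) (f : U -> V).
Hypotheses (hX : zmod_morphism X) (hf : zmod_morphism f).

Let hXf j : zmod_morphism (fun w => iter j X (f w)).
Proof. by elim: j => //= j IH; apply: zmod_morphism_comp. Qed.

Lemma msubst_zmod : zmod_morphism (msubst X f).
Proof. exact: coefsum_zmod hXf. Qed.

Lemma msubst_constp w : msubst X f (constp w) = f w.
Proof. exact: (coefsum_monom hXf w 0). Qed.

(** Universal property of $U[\lambda]$: an additive map is determined by its values on constants and
    by the operator that multiplication by $\lambda$ becomes. Identities between substitutions below
    are reduced to these two checks. *)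
Lemma msubst_unique (F : {malg U[nat]} -> V) :
  zmod_morphism F -> (forall w, F (constp w) = f w) ->
  (forall P, F (mulvar P) = X (F P)) -> F =1 msubst X f.
Proof.
move=> hF F0 FX P; rewrite {1}[P]monalgE (zmod_morph_sum hF).
apply: eq_bigr => j _; elim: j (P@_j) => [|j IH] w; first exact: F0.
by rewrite -mulvar_monom FX IH.
Qed.

Lemma msubst_mulvar P : msubst X f (mulvar P) = X (msubst X f P).
Proof.
rewrite {1 2}[P]monalgE (zmod_morph_sum (@mulvar_zmod U)).
rewrite !(zmod_morph_sum msubst_zmod).
rewrite (zmod_morph_sum hX); apply: eq_bigr => j _.
by rewrite mulvar_monom /msubst !(coefsum_monom hXf).
Qed.

End Msubst.

Lemma eq_msubst (X X' : V -> V) (f f' : U -> V) :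
  X =1 X' -> f =1 f' -> msubst X f =1 msubst X' f'.
Proof.
move=> eX ef P; apply: eq_bigr => j _; rewrite ef.
by elim: j (f' _) => //= j IH w; rewrite IH eX.
Qed.

Lemma eq_msubstl (X X' : V -> V) (f : U -> V) :
  X =1 X' -> msubst X f =1 msubst X' f.
Proof. by move=> eX; apply: eq_msubst. Qed.

Lemma eq_msubstr (X : V -> V) (f f' : U -> V) :
  f =1 f' -> msubst X f =1 msubst X f'.
Proof. exact: eq_msubst. Qed.

Lemma coefmapE (f : U -> V) P :
  coefmap f P = msubst (@mulvar V) (fun w => constp (f w)) P.
Proof. by apply: eq_bigr => j _; rewrite iter_mulvar. Qed.

Lemma eq_coefmap (f f' : U -> V) : f =1 f' -> coefmap f =1 coefmap f'.
Proof. by move=> ef P; apply: eq_bigr => j _; rewrite ef. Qed.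

Lemma msubstB (X : V -> V) (f g : U -> V) P : zmod_morphism X ->
  msubst X (fun w => f w - g w) P = msubst X f P - msubst X g P.
Proof.
move=> hX; rewrite -sumrB; apply: eq_bigr => j _.
by elim: j (f _) (g _) => //= j IH x y; rewrite IH hX.
Qed.

End OneVariable.

Section Coefmap.
Variables (U V : zmodType) (f : U -> V).
Hypothesis hf : zmod_morphism f.

Let hcf := zmod_morphism_comp (@constp_zmod V) hf.

Lemma coefmap_zmod : zmod_morphism (coefmap f).
Proof. by move=> P Q; rewrite !coefmapE (msubst_zmod (@mulvar_zmod V) hcf). Qed.

Lemma coefmap_constp w : coefmap f (constp w) = constp (f w).
Proof. by rewrite coefmapE (msubst_constp (@mulvar_zmod V) hcf). Qed.

Lemma coefmap_mulvar P : coefmap f (mulvar P) = mulvar (coefmap f P).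
Proof. by rewrite !coefmapE (msubst_mulvar (@mulvar_zmod V) hcf). Qed.

End Coefmap.

Section Compositions.
Variables U V W : zmodType.

Lemma coefmap_comp (g : V -> W) (f : U -> V) P :
  zmod_morphism g -> zmod_morphism f ->
  coefmap g (coefmap f P) = coefmap (fun w => g (f w)) P.
Proof.
move=> hg hf; rewrite [RHS]coefmapE.
move: P; apply: msubst_unique.
- exact: zmod_morphism_comp (coefmap_zmod hg) (coefmap_zmod hf).
- by move=> w; rewrite !coefmap_constp.
- by move=> P; rewrite !coefmap_mulvar.
Qed.

Lemma msubst_coefmap (X : W -> W) (g : V -> W) (f : U -> V) P :
  zmod_morphism X -> zmod_morphism g -> zmod_morphism f ->
  msubst X g (coefmap f P) = msubst X (fun w => g (f w)) P.
Proof.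
move=> hX hg hf; move: P; apply: msubst_unique.
- exact: zmod_morphism_comp (msubst_zmod hX hg) (coefmap_zmod hf).
- by move=> w; rewrite coefmap_constp // msubst_constp.
- by move=> P; rewrite coefmap_mulvar // msubst_mulvar.
Qed.

(** An additive map intertwining [X] with [Y] carries substitution of [X] to substitution of [Y]. *)
Lemma map_msubst (F : V -> W) (X : V -> V) (Y : W -> W) (f : U -> V) P :
  zmod_morphism F -> zmod_morphism X -> zmod_morphism f ->
  (forall v, F (X v) = Y (F v)) ->
  F (msubst X f P) = msubst Y (fun w => F (f w)) P.
Proof.
move=> hF hX hf FX; move: P; apply: msubst_unique.
- exact: zmod_morphism_comp hF (msubst_zmod hX hf).
- by move=> w; rewrite msubst_constp.
- by move=> P; rewrite msubst_mulvar.
Qed.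

End Compositions.

(** * The substitution $\lambda\mapsto-\lambda-\partial$ *)

Section SkewSubstitution.
Variable K : fieldType.

Lemma partial_zmod (W : lmodType {poly K}) : zmod_morphism (@partial K W).
Proof. by move=> x y; rewrite /partial scalerBr. Qed.

Section Basics.
Variable W : lmodType {poly K}.
Implicit Types (P Q : {malg W[nat]}).

Let skewX Q := - mulvar Q - coefmap (@partial K W) Q.

Let skewX_zmod : zmod_morphism skewX.
Proof.
apply: zmod_morphism_sub (coefmap_zmod (@partial_zmod W)).
by move=> x y; rewrite mulvar_zmod opprB opprK addrC.
Qed.

Lemma skew_subst_zmod : zmod_morphism (@skew_subst K W).
Proof. exact: msubst_zmod skewX_zmod (@constp_zmod W). Qed.

Lemma skew_subst_constp w : skew_subst (constp w) = constp w :> {malg W[nat]}.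
Proof. exact: msubst_constp skewX_zmod (@constp_zmod W) w. Qed.

Lemma skew_subst_mulvar P : skew_subst (mulvar P) =
  - mulvar (skew_subst P) - coefmap (@partial K W) (skew_subst P).
Proof. exact: msubst_mulvar skewX_zmod (@constp_zmod W) P. Qed.

Lemma map_skew_subst (V : zmodType) (F : {malg W[nat]} -> V) (Y : V -> V) P :
  zmod_morphism F ->
  (forall Q, F (- mulvar Q - coefmap (@partial K W) Q) = Y (F Q)) ->
  F (skew_subst P) = msubst Y (fun w => F (constp w)) P.
Proof. by move=> hF; exact: map_msubst hF skewX_zmod (@constp_zmod W). Qed.

End Basics.

Lemma skew_subst_coefmap (V W : lmodType {poly K}) (f : V -> W) P :
  zmod_morphism f -> (forall v, f (partial v) = partial (f v)) ->
  skew_subst (coefmap f P) = coefmap f (skew_subst P).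
Proof.
move=> hf fd; have hcf := coefmap_zmod hf.
have hd := @partial_zmod.
rewrite (map_skew_subst (F := coefmap f)
  (Y := fun Q => - mulvar Q - coefmap (@partial K W) Q)) //; last first.
  move=> Q; rewrite hcf (zmod_morphN hcf) coefmap_mulvar //.
  rewrite (coefmap_comp _ hf (hd V)) (coefmap_comp _ (hd W) hf).
  by congr (_ - _); apply: eq_coefmap => v; rewrite fd.
move: P; apply: msubst_unique.
- exact: zmod_morphism_comp (@skew_subst_zmod W) hcf.
- by move=> w; rewrite coefmap_constp // skew_subst_constp.
- by move=> P; rewrite coefmap_mulvar // skew_subst_mulvar.
Qed.

(** If [h] turns $\partial$ on coefficients into an operator [E] commuting with [X], then putting
    [X] for $\lambda$ in $P(-\lambda-\partial)$ amounts to putting $-X-E$ for $\lambda$ in $P$. *)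
Lemma msubst_skew_subst (W : lmodType {poly K}) (V : zmodType) (X E : V -> V)
    (h : W -> V) P :
  zmod_morphism X -> zmod_morphism E -> zmod_morphism h ->
  (forall v, E (X v) = X (E v)) -> (forall w, h (partial w) = E (h w)) ->
  msubst X h (skew_subst P) = msubst (fun v => - X v - E v) h P.
Proof.
move=> hX hE hh EX hd; have hm := msubst_zmod hX hh.
rewrite (map_skew_subst (Y := fun v => - X v - E v)) //.
  by apply: eq_msubst => // w; rewrite msubst_constp.
move=> Q; rewrite hm (zmod_morphN hm) msubst_mulvar //; congr (_ - _).
rewrite msubst_coefmap //; last exact: partial_zmod.
by rewrite (map_msubst (Y := X)) //; apply: eq_msubst.
Qed.

Lemma skew_substK (W : lmodType {poly K}) : involutive (@skew_subst K W).
Proof.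
move=> P; rewrite {1}/skew_subst (msubst_skew_subst
  (E := coefmap (@partial K W)) (h := @constp W)).
- transitivity (msubst (@mulvar W) (@constp W) P); last first.
    exact/esym/(msubst_unique (F := id)).
  (* This is $-(-\lambda-\partial)-\partial=\lambda$. *)
  by apply: eq_msubst => // v /=; rewrite !opprD !opprK addrK.
- apply: zmod_morphism_sub (coefmap_zmod (@partial_zmod W)).
  by move=> x y; rewrite mulvar_zmod opprB opprK addrC.
- exact: coefmap_zmod (@partial_zmod W).
- exact: constp_zmod.
- move=> v; have hd := coefmap_zmod (@partial_zmod W).
  by rewrite hd (zmod_morphN hd) coefmap_mulvar //; exact: partial_zmod.
- by move=> w; rewrite coefmap_constp //; exact: partial_zmod.
Qed.

End SkewSubstitution.

(** * Additivity of sesquilinear products *)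

Section Sesquilinear.
Variables (K : fieldType) (U V W : lmodType {poly K}).
Variable p : U -> V -> {malg W[nat]}.
Hypothesis sp : conformal_sesquilinear p.

Let coefmap_scale1 (P : {malg W[nat]}) :
  coefmap (fun w => (1 : K)%:P *: w) P = P.
Proof.
by rewrite [RHS]monalgE; apply: eq_bigr => j _; rewrite scale1r.
Qed.

Lemma sesqui_zmodl v : zmod_morphism (p^~ v).
Proof.
apply: morphD_zmod => x y.
by have := sesqui_linearl sp 1 x y v; rewrite coefmap_scale1 scale1r.
Qed.

Lemma sesqui_zmodr u : zmod_morphism (p u).
Proof.
apply: morphD_zmod => x y.
by have := sesqui_linearr sp 1 u x y; rewrite coefmap_scale1 scale1r.
Qed.

End Sesquilinear.

(** * Linear forms in $\lambda,\mu,\partial$ acting on $Y[\lambda,\mu]$ *)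

Section TwoVariables.
Variables (K : fieldType) (Y : lmodType {poly K}).
Local Notation Y2 := {malg {malg Y[nat]}[nat]}.
Implicit Types (Q : Y2) (P : {malg Y[nat]}) (s t r : int * int * int).

Definition partial2 : Y2 -> Y2 := coefmap (coefmap (@partial K Y)).

                                                                        
(** The triple $(i,j,k)$ stands for the operator $i\lambda+j\mu+k\partial$. With forms as elements
    of the group $\mathbb{Z}^3$, changes of variables become additive computations there. *)
Definition linop t Q : Y2 :=
  mul_lambda Q *~ t.1.1 + mul_mu Q *~ t.1.2 + partial2 Q *~ t.2.

Local Notation lam := ((1, 0, 0) : int * int * int).
Local Notation mu := ((0, 1, 0) : int * int * int).
Local Notation dd := ((0, 0, 1) : int * int * int).

Let hdY : zmod_morphism (coefmap (@partial K Y)).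
Proof. exact: coefmap_zmod (@partial_zmod K Y). Qed.

Lemma mul_lambda_zmod : zmod_morphism (@mul_lambda Y).
Proof. exact: coefmap_zmod (@mulvar_zmod Y). Qed.

Lemma partial2_zmod : zmod_morphism partial2.
Proof. exact: coefmap_zmod hdY. Qed.

Lemma linop_lam Q : linop lam Q = mul_lambda Q.
Proof. by rewrite /linop !mulr0z !addr0. Qed.

Lemma linop_mu Q : linop mu Q = mul_mu Q.
Proof. by rewrite /linop !mulr0z addr0 add0r. Qed.

Lemma linop_dd Q : linop dd Q = partial2 Q.
Proof. by rewrite /linop !mulr0z !add0r. Qed.

Lemma linopD s t Q : linop (s + t) Q = linop s Q + linop t Q.
Proof.
rewrite /linop; move: (mul_lambda Q) (mul_mu Q) (partial2 Q) => a b c.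
by rewrite !mulrzDr [RHS]addrACA [X in _ = X + _]addrACA.
Qed.

Lemma linopN t Q : linop (- t) Q = - linop t Q.
Proof.
rewrite /linop; move: (mul_lambda Q) (mul_mu Q) (partial2 Q) => a b c.
by rewrite !mulrNz !opprD.
Qed.

Lemma linop_zmod t : zmod_morphism (linop t).
Proof.
move=> x y; rewrite /linop mul_lambda_zmod /mul_mu mulvar_zmod partial2_zmod.
move: (mul_lambda x) (mul_lambda y) (mulvar x) (mulvar y).
move: (partial2 x) (partial2 y).
move=> c c' a a' b b'; rewrite !mulrzBl !opprD [RHS]addrACA.
by rewrite [X in X + _ = _]addrACA.
Qed.

Let comm_linop (G : Y2 -> Y2) : zmod_morphism G ->
  (forall Q, G (mul_lambda Q) = mul_lambda (G Q)) ->
  (forall Q, G (mul_mu Q) = mul_mu (G Q)) ->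
  (forall Q, G (partial2 Q) = partial2 (G Q)) ->
  forall t Q, G (linop t Q) = linop t (G Q).
Proof.
move=> hG hl hm hd t Q; rewrite /linop -hl -hm -hd.
by rewrite -!(zmod_morphMz hG) -!(zmod_morphD hG).
Qed.

Let mul_lambda_mu Q : mul_lambda (mul_mu Q) = mul_mu (mul_lambda Q).
Proof. exact: coefmap_mulvar (@mulvar_zmod Y) Q. Qed.

Let partial2_mu Q : partial2 (mul_mu Q) = mul_mu (partial2 Q).
Proof. exact: coefmap_mulvar hdY Q. Qed.

Let partial2_lambda Q : partial2 (mul_lambda Q) = mul_lambda (partial2 Q).
Proof.
have hm := @mulvar_zmod Y.
rewrite /partial2 /mul_lambda (coefmap_comp Q hdY hm) (coefmap_comp Q hm hdY).
by apply: eq_coefmap => P; rewrite coefmap_mulvar //; exact: partial_zmod.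
Qed.

Lemma linopC s t Q : linop s (linop t Q) = linop t (linop s Q).
Proof.
have hm : zmod_morphism (@mul_mu Y) by exact: mulvar_zmod.
have lamC := comm_linop mul_lambda_zmod (fun=> erefl) mul_lambda_mu
  (fun Q => esym (partial2_lambda Q)).
have muC := comm_linop hm (fun Q => esym (mul_lambda_mu Q)) (fun=> erefl)
  (fun Q => esym (partial2_mu Q)).
have ddC := comm_linop partial2_zmod partial2_lambda partial2_mu (fun=> erefl).
exact: (comm_linop (linop_zmod s) (fun Q => esym (lamC s Q))
  (fun Q => esym (muC s Q)) (fun Q => esym (ddC s Q))).
Qed.

Local Opaque linop.

Let cc (y : Y) : Y2 := constp (constp y).

Let cc_zmod : zmod_morphism cc.
Proof. exact: zmod_morphism_comp (@constp_zmod _) (@constp_zmod Y). Qed.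

                     
(** The value $P(t)\in Y[\lambda,\mu]$ of a polynomial $P\in Y[\lambda]$ at a linear form $t$. *)
Definition ev t P : Y2 := msubst (linop t) (fun y => constp (constp y)) P.

Lemma ev_zmod t : zmod_morphism (ev t).
Proof. exact: msubst_zmod (@linop_zmod t) cc_zmod. Qed.

Lemma ev_constp t y : ev t (constp y) = constp (constp y).
Proof. exact: msubst_constp (@linop_zmod t) cc_zmod y. Qed.

Lemma ev_mulvar t P : ev t (mulvar P) = linop t (ev t P).
Proof. exact: msubst_mulvar (@linop_zmod t) cc_zmod P. Qed.

Let cc_partial y : cc (partial y) = linop dd (cc y).
Proof.
rewrite linop_dd /partial2 /cc coefmap_constp // coefmap_constp //.
exact: partial_zmod.
Qed.

Lemma ev_partial t P : ev t (coefmap (@partial K Y) P) = linop dd (ev t P).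
Proof.
have hl := linop_zmod.
rewrite /ev msubst_coefmap //; last exact: partial_zmod.
rewrite (map_msubst (Y := linop t)) // => [|Q]; last exact: linopC.
by apply: eq_msubstr => y; exact: cc_partial.
Qed.

Lemma ev_skew_subst t P : ev t (skew_subst P) = ev (- t - dd) P.
Proof.
apply: etrans (msubst_skew_subst P (linop_zmod t) (linop_zmod dd) cc_zmod
  (linopC dd t) cc_partial) _.
by apply: eq_msubstl => Q; rewrite linopD !linopN.
Qed.

Lemma ev_lam P : ev lam P = constp P.
Proof.
rewrite /ev; symmetry; move: P; apply: msubst_unique => // [|P].
  exact: constp_zmod.
by rewrite linop_lam /mul_lambda coefmap_constp //; exact: mulvar_zmod.
Qed.

Lemma ev_mu P : ev mu P = coefmap (@constp Y) P.
Proof. by rewrite coefmapE; apply: eq_msubstl => Q; rewrite linop_mu. Qed.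

Section SesquilinearEvaluation.
Variables U V : lmodType {poly K}.
Variable q : U -> V -> {malg Y[nat]}.
Hypothesis sq : conformal_sesquilinear q.

Lemma ev_zmodl t v : zmod_morphism (fun u => ev t (q u v)).
Proof. exact: zmod_morphism_comp (ev_zmod t) (sesqui_zmodl sq v). Qed.

Lemma ev_zmodr t u : zmod_morphism (fun v => ev t (q u v)).
Proof. exact: zmod_morphism_comp (ev_zmod t) (sesqui_zmodr sq u). Qed.

                                                                     
(** In the left factor of a product taken at $r$, $\partial$ acts as $-r$, so $-t-\partial$ becomes
    $r-t$. *)
Lemma msubst_skew_substl t r v (F : {malg U[nat]}) :
  msubst (linop t) (fun u => ev r (q u v)) (skew_subst F) =
  msubst (linop (r - t)) (fun u => ev r (q u v)) F.
Proof.
apply: etrans (msubst_skew_subst F (linop_zmod t) (linop_zmod (- r))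
  (ev_zmodl r v) (linopC (- r) t) _) _ => [u|].
  by rewrite (sesqui_partiall sq) (zmod_morphN (ev_zmod r)) ev_mulvar linopN.
by apply: eq_msubstl => Q; rewrite linopD !linopN opprK addrC.
Qed.

                                                                       
(** In the right factor of a product taken at $r$, $\partial$ acts as $r+\partial$, so $-t-\partial$
    becomes $-t-r-\partial$. *)
Lemma msubst_skew_substr t r u (F : {malg V[nat]}) :
  msubst (linop t) (fun v => ev r (q u v)) (skew_subst F) =
  msubst (linop (- t - r - dd)) (fun v => ev r (q u v)) F.
Proof.
apply: etrans (msubst_skew_subst F (linop_zmod t) (linop_zmod (r + dd))
  (ev_zmodr r u) (linopC (r + dd) t) _) _ => [v|].
  rewrite (sesqui_partialr sq) (zmod_morphD (ev_zmod r)).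
  by rewrite ev_mulvar ev_partial linopD addrC.
apply: eq_msubstl => Q; rewrite !linopD !linopN. 
by rewrite (opprD (linop r Q)) addrA.
Qed.

End SesquilinearEvaluation.

Section Associativity.
Variables U V W X X' : lmodType {poly K}.
Variables (p : U -> V -> {malg X[nat]}) (q : X -> W -> {malg Y[nat]}).
Variables (p' : V -> W -> {malg X'[nat]}) (q' : U -> X' -> {malg Y[nat]}).
Hypotheses (sq : conformal_sesquilinear q) (sq' : conformal_sesquilinear q').

                                     
(** Apply the substitution $\lambda\mapsto t$, $\mu\mapsto s$ to both sides of $(u_\lambda
    v)_{\lambda+\mu}w=u_\lambda(v_\mu w)$. It is well behaved because linear forms commute as
    operators. *)
Lemma assoc_linop t s u v w : nestl p q u v w = nestr p' q' u v w ->
  msubst (linop t) (fun x => ev (t + s) (q x w)) (p u v) =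
  msubst (linop s) (fun x => ev t (q' u x)) (p' v w).
Proof.
have hl := linop_zmod; have hev := ev_zmod.
pose Phi : Y2 -> Y2 := msubst (linop s) (ev t).
have hPhi : zmod_morphism Phi by exact: msubst_zmod.
have Phi_mu Q : Phi (mul_mu Q) = linop s (Phi Q) by exact: msubst_mulvar.
have Phi_lam Q : Phi (mul_lambda Q) = linop t (Phi Q).
  rewrite (map_msubst Q (hl t) (hl s) (hev t) (linopC t s)).
  apply: etrans (msubst_coefmap Q (hl s) (hev t) (@mulvar_zmod Y)) _.
  by apply: eq_msubstr => P; exact: ev_mulvar.
have lam_mu_zmod : zmod_morphism (fun Q : Y2 => mul_lambda Q + mul_mu Q).
  by move=> x y; rewrite mul_lambda_zmod /mul_mu mulvar_zmod opprD addrACA.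
(* The outer product on the left is taken at $\lambda+\mu$, which the substitution sends to
   $t+s$. *)
have Phi_lam_mu Q : Phi (mul_lambda Q + mul_mu Q) = linop (t + s) (Phi Q).
  by rewrite (zmod_morphD hPhi) Phi_mu Phi_lam linopD.
have Phi_cc y : Phi (cc y) = cc y.
  exact: etrans (msubst_constp (hl s) (hev t) (constp y)) (ev_constp t y).
have hq := sesqui_zmodl sq w.
have sum_zmod := msubst_zmod lam_mu_zmod cc_zmod.
move/(congr1 Phi); rewrite /nestr /nestl.
rewrite (map_msubst _ hPhi mul_lambda_zmod
  (zmod_morphism_comp sum_zmod hq) Phi_lam).
have -> : Phi (coefmap (q' u) (p' v w)) =
    msubst (linop s) (fun x => ev t (q' u x)) (p' v w).
  exact: msubst_coefmap (hl s) (hev t) (sesqui_zmodr sq' u).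
move=> <-; apply: eq_msubstr => x.
rewrite (map_msubst _ hPhi lam_mu_zmod cc_zmod Phi_lam_mu).
by symmetry; exact: eq_msubstr Phi_cc _.
Qed.

End Associativity.

Lemma nestlE (U V W X : lmodType {poly K}) (p : U -> V -> {malg X[nat]})
    (q : X -> W -> {malg Y[nat]}) u v w :
  nestl p q u v w =
  msubst (linop lam) (fun x => ev (lam + mu) (q x w)) (p u v).
Proof.
apply: eq_msubst => [Q|x]; first by rewrite linop_lam.
by apply: eq_msubstl => Q; rewrite linopD linop_lam linop_mu.
Qed.

Lemma nestrE (U V W X : lmodType {poly K}) (p : V -> W -> {malg X[nat]})
    (q : U -> X -> {malg Y[nat]}) u v w :
  nestr p q u v w = msubst (linop mu) (fun x => ev lam (q u x)) (p v w).
Proof.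
rewrite /nestr coefmapE; apply: eq_msubst => [Q|x]; first by rewrite linop_mu.
by rewrite ev_lam.
Qed.

Lemma nestr_swapE (U V W X : lmodType {poly K}) (p : U -> W -> {malg X[nat]})
    (q : V -> X -> {malg Y[nat]}) u v w :
  nestr_swap p q u v w = msubst (linop lam) (fun x => ev mu (q v x)) (p u w).
Proof.
by apply: eq_msubst => [Q|x]; rewrite ?linop_lam ?ev_mu.
Qed.

End TwoVariables.

                                                                               
Local Opaque skew_subst ev msubst linop.

(** * The representation attached to a bimodule *)

Lemma cancel_crossed_terms (V : zmodType) (x1 x2 x3 x4 x5 x6 : V) :
  x1 - x2 - (x6 - x5) =
  x1 - x3 - (x4 - x5) - (x2 - x4 - (x3 - x6)).
Proof.
rewrite !opprD !opprK [RHS](AC ((2*2)*(2*2)) (((1*5)*(8*4))*((2*7)*(3*6)))).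
by rewrite /= !addNr !addr0.
Qed.

Section BimoduleRepresentation.
Variables (K : fieldType) (A M : lmodType {poly K}).
Variable mulA : A -> A -> {malg A[nat]}.
Variables (lact : A -> M -> {malg M[nat]}) (ract : M -> A -> {malg M[nat]}).
Hypothesis bimod : conformal_bimodule mulA lact ract.

Local Notation rho := (bimod_rep lact ract).
Local Notation lam := ((1, 0, 0) : int * int * int).
Local Notation mu := ((0, 1, 0) : int * int * int).
Local Notation dd := ((0, 0, 1) : int * int * int).

Let sl := bimod_lsesqui bimod.
Let sr := bimod_rsesqui bimod.

Let scale_zmod (c : K) : zmod_morphism (fun w : M => c%:P *: w).
Proof. by move=> x y; rewrite scalerBr. Qed.

(** The substitution $\lambda\mapsto-\lambda-\partial$ exchanges $-\lambda$ and $\partial+\lambda$.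
    It thus turns the left rule of the right action into the right rule needed for $\rho$, and
    conversely. *)
Lemma bimod_rep_sesqui : conformal_sesquilinear rho.
Proof.
have hS := @skew_subst_zmod K M; have hd := @partial_zmod K M.
have scaleS c P : skew_subst (coefmap (fun w : M => c%:P *: w) P) =
    coefmap (fun w : M => c%:P *: w) (skew_subst P).
  apply: skew_subst_coefmap => // w.
  by rewrite /partial !scalerA mulrC.
have hc c := coefmap_zmod (scale_zmod c).
split=> *; rewrite /bimod_rep.
- rewrite (sesqui_linearl sl) (sesqui_linearr sr) (zmod_morphD hS) scaleS hc.
  by rewrite opprD addrACA.
- rewrite (sesqui_linearr sl) (sesqui_linearl sr) (zmod_morphD hS) scaleS hc.
  by rewrite opprD addrACA.
- rewrite (sesqui_partiall sl) (sesqui_partialr sr) (zmod_morphD hS).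
  rewrite skew_subst_mulvar skew_subst_coefmap // mulvar_zmod.
  by rewrite [X in _ - X]addrC subrK opprK opprB addrC.
- rewrite (sesqui_partialr sl) (sesqui_partiall sr) (zmod_morphN hS).
  rewrite skew_subst_mulvar (coefmap_zmod hd) mulvar_zmod.
  by rewrite opprK [- mulvar _ - _]addrC addrACA.
Qed.

Let evB t (P Q : {malg M[nat]}) : ev t (P - Q) = ev t P - ev t Q.
Proof. exact: ev_zmod. Qed.

Section Terms.
Variable v : M.
Implicit Types (t s : int * int * int) (a b : A).

                                                    
Definition llact_at t s a b :=
  msubst (linop s) (fun x => ev t (lact a x)) (lact b v).
Definition lract_at t s a b :=
  msubst (linop s) (fun x => ev t (lact a x)) (ract v b).
Definition rract_at t s a b :=
  msubst (linop t) (fun x => ev (t + s) (ract x b)) (ract v a).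

                                          
(** The form completing $t$ and $s$ to a triple whose sum is $-\partial$. *)
Definition third t s := - (t + s) - dd.

Lemma thirdC t s : third t s = third s t.
Proof. by rewrite /third [t + s]addrC. Qed.

Lemma add_third t s : third t s + s = - t - dd.
Proof. by rewrite /third opprD addrAC subrK. Qed.

(** Write $n$ for [third t s]. Expanding $\rho(a)_t(\rho(b)_s v)$ gives $a_t(b_s v)$, $a_t(v_n b)$,
    $(b_s v)_{s+n}a$ and $(v_n b)_{n+s}a$, since $-t-\partial=n+s$. *)
Lemma rep_rep_linop t s a b :
  msubst (linop s) (fun x => ev t (rho a x)) (rho b v) =
  llact_at t s a b - lract_at t (third t s) a b
  - (lract_at s (third t s) b a - rract_at (third t s) s b a).
Proof.
have hl := @linop_zmod K M.
have -> : msubst (linop s) (fun x => ev t (rho a x)) (rho b v) =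
    msubst (linop s)
      (fun x => ev t (lact a x) - ev (third t s + s) (ract x a)) (rho b v).
  by apply: eq_msubstr => x; rewrite evB ev_skew_subst add_third.
rewrite (msubstB _ _ _ (hl s)) (msubst_zmod (hl s) (ev_zmodr sl t a)).
rewrite (msubst_zmod (hl s) (ev_zmodl sr (third t s + s) a)).
rewrite (msubst_skew_substr sl) (msubst_skew_substl sr) addrK.
have -> : - s - t - dd = third t s by rewrite /third opprD [- s - t]addrC.
(* Compatibility of the two actions rewrites $(b_s v)_{s+n}a$ as $b_s(v_n a)$, the shape that also
   arises with $a,b$ and $t,s$ exchanged. *)
have := assoc_linop sr sl s (third t s) (bimod_lract bimod b v a).
by rewrite [s + _]addrC => ->.
Qed.

(** Here $\rho$ is taken at $t+s$, so the right action is taken at $n=-(t+s)-\partial$. In both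
    actions the skew substitution in the commutator replaces $t$ by $s$; associativity then gives
    iterated actions of $a$ and $b$ on $v$. *)
Lemma rep_commutator_linop t s a b :
  msubst (linop t) (fun x => ev (t + s) (rho x v)) (commutator mulA a b) =
  llact_at t s a b - llact_at s t b a
  - (rract_at (third t s) t a b - rract_at (third t s) s b a).
Proof.
have hl := @linop_zmod K M.
have -> :
    msubst (linop t) (fun x => ev (t + s) (rho x v)) (commutator mulA a b) =
    msubst (linop t)
      (fun x => ev (t + s) (lact x v) - ev (third t s) (ract v x))
      (commutator mulA a b).
  by apply: eq_msubstr => x; rewrite evB ev_skew_subst.
rewrite (msubstB _ _ _ (hl t)) (msubst_zmod (hl t) (ev_zmodl sl (t + s) v)).
rewrite (msubst_zmod (hl t) (ev_zmodr sr (third t s) v)).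
rewrite (msubst_skew_substl sl) (msubst_skew_substr sr).
have -> : - t - third t s - dd = s.
  by rewrite /third opprD !opprK addrA addrK addKr.
rewrite (assoc_linop sl sl t s (bimod_lact bimod a b v)).
have -> : t + s - t = s by rewrite addrAC subrr add0r.
rewrite [t + s]addrC (assoc_linop sl sl s t (bimod_lact bimod b a v)).
rewrite -(assoc_linop sr sr _ t (bimod_ract bimod v a b)).
by rewrite -(assoc_linop sr sr _ s (bimod_ract bimod v b a)).
Qed.

End Terms.

Lemma bimod_rep_bracket a b v : nestl (commutator mulA) rho a b v =
  nestr rho rho a b v - nestr_swap rho rho a b v.
Proof.
rewrite nestlE nestrE nestr_swapE !rep_rep_linop rep_commutator_linop.
(* Since $n$ is symmetric in $\lambda,\mu$, the mixed terms of the two iterated actions coincide and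
   cancel in the difference. *)
rewrite [third mu lam]thirdC; move: (third lam mu) => n.
move: (llact_at v lam mu a b) (llact_at v mu lam b a) (lract_at v lam n a b)
  (lract_at v mu n b a) (rract_at v n mu b a) (rract_at v n lam a b).
move=> x1 x2 x3 x4 x5 x6; exact: cancel_crossed_terms.
Qed.

Lemma bimod_rep_representation :
  lie_representation (commutator mulA) (bimod_rep lact ract).
Proof. by split; [exact: bimod_rep_sesqui|exact: bimod_rep_bracket]. Qed.

(** Both products in the commutator lie in the image of $T$, and $T$ can be pulled out of the skew
    substitution because it is $\mathbb{C}[\partial]$-linear. *)
Lemma O_operator_commutator (T : {linear M -> A}) :
  O_operator mulA lact ract T ->
  lie_O_operator (commutator mulA) (bimod_rep lact ract) T.
Proof.
move=> OT m n; have hT : zmod_morphism T by exact: raddfB.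
have hS := @skew_subst_zmod K M; have hcT := coefmap_zmod hT.
rewrite /commutator !OT skew_subst_coefmap //; last first.
  by move=> v; rewrite /partial linearZ.
(* By involutivity the doubly substituted term of $-\rho(T(n))_{-\lambda-\partial}m$ is $m_\lambda
   T(n)$. *)
rewrite -hcT (zmod_morphD hS) /bimod_rep hS skew_substK.
by rewrite !opprD !opprK [in LHS](AC (2*2) ((1*4)*(3*2))) /=.
Qed.

End BimoduleRepresentation.

(** For the regular bimodule, $\rho$ is the commutator bracket itself, so sesquilinearity and Jacobi
    are the representation axioms; skew-symmetry is involutivity of the substitution. *)
Lemma associative_lie_conformal (K : fieldType) (A : lmodType {poly K})
    (mulA : A -> A -> {malg A[nat]}) :
  associative_conformal mulA -> lie_conformal (commutator mulA).
Proof.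
case=> sA assA.
have regular : conformal_bimodule mulA mulA mulA by split.
split.
- exact: bimod_rep_sesqui regular.
- move=> a b; rewrite /commutator (@skew_subst_zmod K A) skew_substK.
  by rewrite opprB.
- move=> a b c; rewrite (bimod_rep_bracket regular).
  by rewrite subrK.
Qed.

Theorem theorem3p12 (R : realType) (A M : lmodType {poly R[i]})
    (mulA : A -> A -> {malg A[nat]})
    (lact : A -> M -> {malg M[nat]}) (ract : M -> A -> {malg M[nat]})
    (T : {linear M -> A}) :
  associative_conformal mulA ->
  conformal_bimodule mulA lact ract ->
  O_operator mulA lact ract T ->
  [/\ lie_conformal (commutator mulA),
      lie_representation (commutator mulA) (bimod_rep lact ract) &
      lie_O_operator (commutator mulA) (bimod_rep lact ract) T].
Proof.
move=> assocA bimod OT; split.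
- exact: associative_lie_conformal.
- exact: bimod_rep_representation.
- exact: O_operator_commutator.
Qed.
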